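(* Let $w$ be a double occurrence word in ascending order and $\nu\in\mathbb{N}$. Suppose $z_1z_2z_3$ is a factor of $w$ for some single occurrence words $z_1,z_3$ and some word $z_2\in\Sigma^*$. If one of the following holds: (1) $z_1z_3$ is a repeat word in $w$; (2) $z_1z_3\sim\mathrm{Int}(h,\nu)$ for some $h\ge1$; (3) $z_1z_3\sim\mathrm{Nes}(h,\nu)$ for some $h\ge1$; (4) $z_1z_3$ is a return word in $w$; (5) $z_1z_2z_3\sim T_\rho(\nu,m,j)$ for some $m\ge0$, $j\ge1$; (6) $z_1z_2z_3\sim T_\tau(\nu,m,j)$ for some $m\ge0$ divisible by $\nu$ and $j\ge1$; then there exist two insertions $\mathcal{I}_1(\nu,k_1,\ell_1)$ and $\mathcal{I}_2(\nu,k_2,\ell_2)$ into $w$ with $(k_1,\ell_1)\ne(k_2,\ell_2)$ such that $w\star\mathcal{I}_1(\nu,k_1,\ell_1)\sim w\star\mathcal{I}_2(\nu,k_2,\ell_2)$. Moreover, they can be taken to be: in case (1) both repeat insertions and interleaving ($k_1<k_2\le\ell_1<\ell_2$); in case (2) both return insertions and interleaving; in case (3) both repeat insertions and nested ($k_1<k_2\le\ell_2<\ell_1$); in case (4) both return insertions and nested; in case (5) both repeat insertions and sequential ($k_1\le\ell_1<k_2\le\ell_2$); in case (6) both return insertions and sequential.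
   Context: Alphabet $\Sigma=\mathbb{N}=\{1,2,\dots\}$; $\Sigma^*$ is the set of finite words, $|w|$ length, $w^R$ reverse. A word $v$ is a factor of $w$ if $w=avb$ for words $a,b$. A double occurrence word (DOW) is a word in which every symbol occurs either zero or exactly two times; a single occurrence word (SOW) is a nonempty word with pairwise distinct symbols. An equivalence map is a morphism of $\Sigma^*$ induced by a bijection $\Sigma\to\Sigma$; $x\sim y$ means $f(x)=y$ for some equivalence map $f$. A word is in ascending order if it is empty or its first symbol is $1$ and the first occurrence of each symbol is one greater than the largest symbol preceding it. For a SOW $v$, $vv$ is a repeat word in $w$ if $w=avbvc$ for some words $a,b,c$, and $vv^R$ is a return word in $w$ if $w=avbv^Rc$. Insertions: let $w$ be a DOW in ascending order, $M$ its largest symbol ($M=0$ if $w$ is empty), $\nu\ge1$, $u=(M+1)(M+2)\cdots(M+\nu)$. For $1\le k\le\ell\le|w|+1$ write $w=y_1y_2y_3$ with $|y_1|=k-1$, $|y_1y_2|=\ell-1$. The repeat insertion gives $w\star\rho(\nu,k,\ell)=y_1uy_2uy_3$ and the return insertion gives $w\star\tau(\nu,k,\ell)=y_1uy_2u^Ry_3$; $\mathcal I(\nu,k,\ell)$ denotes either. For $h,\nu\ge1$ let $x_i=((i-1)\nu+1)\cdots(i\nu)$ for $1\le i\le h$; $\mathrm{Int}(h,\nu)=x_1\cdots x_hx_1^R\cdots x_h^R$ and $\mathrm{Nes}(h,\nu)=x_1\cdots x_hx_h\cdots x_1$. Tangled cords: for $m\ge0$, $\nu,j\ge1$, let $s_0=12\cdots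 m12\cdots m$ ($\epsilon$ if $m=0$), $s_j=s_{j-1}\star\rho(\nu,|s_{j-1}|-m+1,|s_{j-1}|+1)$, $T_\rho(\nu,m,j)=s_j$. If $\nu\mid m$, let $t_0=\mathrm{Int}(m/\nu,\nu)$ ($\epsilon$ if $m=0$), $t_j=t_{j-1}\star\tau(\nu,|t_{j-1}|-m+1,|t_{j-1}|+1)$, $T_\tau(\nu,m,j)=t_j$. *)

(* Defs.v *)
From mathcomp Require Import all_boot.

Set Implicit Arguments.
Unset Strict Implicit.
Unset Printing Implicit Defensive.

(* The alphabet is {1, 2, ...}; 0 : nat is not a symbol.  Ascending words (and
   hence their factors) and all the words constructed below avoid 0. *)
Definition word := seq nat.

Definition factor (v w : word) : Prop := exists a b : word, w = a ++ v ++ b.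

Definition dow (w : word) : Prop :=
  forall a : nat, count_mem a w = 0 \/ count_mem a w = 2.

Definition sow (v : word) : Prop := v <> [::] /\ uniq v.

(* A bijection of {1, 2, ...} is encoded as a bijection of nat fixing 0. *)
Definition equivalent (x y : word) : Prop :=
  exists f : nat -> nat, [/\ bijective f, f 0 = 0 & map f x = y].

(* The largest symbol of w, and 0 if w is empty. *)
Definition max_symbol (w : word) : nat := \max_(a <- w) a.

Definition ascending (w : word) : Prop :=
  w = [::] \/
  (head 0 w = 1 /\
   forall i, 0 < i < size w -> nth 0 w i \notin take i w ->
     nth 0 w i = (max_symbol (take i w)).+1).

Definition repeat_word_in (x w : word) : Prop :=
  exists v : word, [/\ sow v, x = v ++ v &
    exists a b c : word, w = a ++ v ++ b ++ v ++ c].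

Definition return_word_in (x w : word) : Prop :=
  exists v : word, [/\ sow v, x = v ++ rev v &
    exists a b c : word, w = a ++ v ++ b ++ rev v ++ c].

Variant insertion_kind := Repeat | Return.

(* Positions are counted from 1. *)
Definition insertion_positions (w : word) (k l : nat) : Prop :=
  [/\ 1 <= k, k <= l & l <= size w + 1].

Definition new_word (nu : nat) (w : word) : word :=
  iota (max_symbol w + 1) nu.

(* Meaningful when insertion_positions w k l holds. *)
Definition insert (w : word) (I : insertion_kind) (nu k l : nat) : word :=
  let u := new_word nu w in
  let u' := match I with Repeat => u | Return => rev u end in
  let y1 := take (k - 1) w in
  let y2 := drop (k - 1) (take (l - 1) w) in
  let y3 := drop (l - 1) w in
  y1 ++ u ++ y2 ++ u' ++ y3.

Definition equivalent_insertions (w : word) (nu : nat)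
    (I1 : insertion_kind) (k1 l1 : nat)
    (I2 : insertion_kind) (k2 l2 : nat) : Prop :=
  [/\ insertion_positions w k1 l1, insertion_positions w k2 l2,
      (k1, l1) <> (k2, l2) &
      equivalent (insert w I1 nu k1 l1) (insert w I2 nu k2 l2)].

Definition interleaving (k1 l1 k2 l2 : nat) : Prop :=
  [/\ k1 < k2, k2 <= l1 & l1 < l2].

Definition nested (k1 l1 k2 l2 : nat) : Prop :=
  [/\ k1 < k2, k2 <= l2 & l2 < l1].

Definition sequential (k1 l1 k2 l2 : nat) : Prop :=
  [/\ k1 <= l1, l1 < k2 & k2 <= l2].

(* x_i, for i >= 1 *)
Definition block (nu i : nat) : word := iota ((i - 1) * nu + 1) nu.

Definition Int (h nu : nat) : word :=
  flatten [seq block nu i | i <- iota 1 h] ++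
  flatten [seq rev (block nu i) | i <- iota 1 h].

Definition Nes (h nu : nat) : word :=
  flatten [seq block nu i | i <- iota 1 h] ++
  flatten [seq block nu i | i <- rev (iota 1 h)].

(* In both recursions the previous word s has size s >= 2 * m, so that the
   subtraction size s - m is not truncated. *)
Fixpoint T_rho (nu m j : nat) : word :=
  match j with
  | 0 => iota 1 m ++ iota 1 m
  | j'.+1 => let s := T_rho nu m j' in
             insert s Repeat nu (size s - m + 1) (size s + 1)
  end.

(* Meaningful when nu divides m. *)
Fixpoint T_tau (nu m j : nat) : word :=
  match j with
  | 0 => Int (m %/ nu) nu
  | j'.+1 => let t := T_tau nu m j' in
             insert t Return nu (size t - m + 1) (size t + 1)
  end.

(* Main.v *)
(* In every case the two inserted words are carried to each other by a
   permutation of the new letters together with the letters of z1 (cases 1 to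
   4) or of z1 z2 z3 (cases 5 and 6); since w is a double occurrence word, these
   letters do not occur elsewhere, so the rest of w is left alone.
   In cases 1 to 4 the permutation turns u z1 into z1 u letter by letter. As the
   blocks of Int and Nes have the length of u, it is then a rotation of blocks,
   which is why it acts correctly on z3 as well.
   For tangled cords, insertion at the left end commutes with insertion at the
   right end.  If inserting u at either end of s gives equivalent words, then so
   it does for the next cord: left(u, right(v, s)) = right(v, left(u, s)) is
   equivalent to right(v, right(u, s)), and exchanging u and v gives
   right(u, right(v, s)). *)

Require Import Defs.
From mathcomp Require Import all_boot.
From mathcomp Require Import zify.

Set Implicit Arguments.
Unset Strict Implicit.
Unset Printing Implicit Defensive.

(** * Insertion at the two ends of a word, and renamings of finite support *)

Definition copy (I : insertion_kind) (u : word) : word :=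
  match I with Repeat => u | Return => rev u end.

Definition fixes_off (S : word) (f : nat -> nat) : Prop :=
  forall c, c \notin S -> f c = c.

(** Unlike in [insert], the inserted word [u] is arbitrary here, so that two fresh words can be
    inserted in either order and renamings can be pushed through. *)
Definition right_insert (I : insertion_kind) (m : nat) (u s : word) : word :=
  take (size s - m) s ++ u ++ drop (size s - m) s ++ copy I u.

Definition left_insert (I : insertion_kind) (m : nat) (u s : word) : word :=
  u ++ take m s ++ copy I u ++ drop m s.

Lemma map_copy I (f : nat -> nat) u : map f (copy I u) = copy I (map f u).
Proof. by case: I => //=; rewrite map_rev. Qed.

Lemma count_copy I (a : pred nat) u : count a (copy I u) = count a u.
Proof. by case: I => //=; rewrite count_rev. Qed.

Lemma map_fixed S f x : fixes_off S f -> {in x, forall c, c \notin S} ->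
  map f x = x.
Proof. by move=> Sf xS; apply: map_id_in => c /xS; apply: Sf. Qed.

Lemma fixes_off_sub S S' f : {subset S <= S'} ->
  fixes_off S f -> fixes_off S' f.
Proof. by move=> sub Sf c cS'; apply: Sf; apply: contra cS' => /sub. Qed.

(** The i-th letter of [p] goes to the i-th letter of [q], and all other letters stay. As [p] and
    [q] have the same letters, exchanging their roles gives the inverse. *)
Lemma renaming_of_perm (p q : word) : uniq p -> perm_eq p q ->
  exists f, [/\ bijective f, fixes_off p f & map f p = q].
Proof.
move=> up pq; have uq : uniq q by rewrite -(perm_uniq pq).
have mpq := perm_mem pq; have spq := perm_size pq.
pose ren (p q : word) c := if c \in p then nth 0 q (index c p) else c.
have renK (r s : word) : uniq s -> size r = size s -> r =i s ->
    cancel (ren r s) (ren s r).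
  move=> us srs mrs c; rewrite /ren.
  case cr: (c \in r); last by rewrite -mrs cr.
  by rewrite mem_nth ?index_uniq ?nth_index // -srs index_mem.
exists (ren p q); split.
- by exists (ren q p); apply: renK.
- by move=> c; rewrite /ren => /negbTE ->.
apply: (@eq_from_nth _ 0) => [|i]; rewrite size_map // => ip.
by rewrite (nth_map 0) // /ren mem_nth // index_uniq.
Qed.

Lemma swap_renaming (u v : word) : uniq (u ++ v) ->
  exists f, [/\ bijective f, fixes_off (u ++ v) f & map f (u ++ v) = v ++ u].
Proof. by move=> uv; apply: renaming_of_perm => //; rewrite perm_catC. Qed.

Lemma mem_flatten_rev (X : seq word) : flatten (rev X) =i flatten X.
Proof. by apply: perm_mem; apply: perm_flatten; rewrite perm_rev. Qed.

Lemma mem_flatten_map_rev (X : seq word) : flatten (map rev X) =i flatten X.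
Proof.
by elim: X => //= x X IH c; rewrite !mem_cat mem_rev IH.
Qed.

(* The blocks of [u :: X] have equal sizes, so the renaming that takes the
   concatenation of [u :: X] to that of [rcons X u] does so block by block. *)
Lemma block_rotation (u : word) (X : seq word) :
  all (fun x => size x == size u) X -> uniq (u ++ flatten X) ->
  exists f, [/\ bijective f, fixes_off (u ++ flatten X) f,
    map f (u ++ flatten X) = flatten X ++ u,
    map f (rev u ++ flatten (map rev X)) = flatten (map rev X) ++ rev u &
    map f (flatten (rev X) ++ u) = u ++ flatten (rev X)].
Proof.
move=> sX /swap_renaming[f [bf ff mf]]; exists f.
have /all_pred1P shX : all (pred1 (size u)) (shape X) by rewrite all_map.
(* Both lists have the same concatenation by the choice of [f], and the same shape because every
   block is as long as [u]. *)
have rot : [seq map f x | x <- u :: X] = rcons X u.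
  apply: eq_from_flatten_shape.
    by rewrite -map_flatten /= mf flatten_rcons.
  rewrite /shape -map_comp (eq_map (g := size)) => [|x]; last first.
    by rewrite /= size_map.
  rewrite map_rcons /= -/(shape X) shX -cats1.
  by rewrite -[[:: size u]]/(nseq 1 _) -nseqD addn1.
split=> //.
  rewrite -[rev u ++ _]/(flatten (map rev (u :: X))) -flatten_rcons -map_rcons.
  rewrite -rot map_flatten -!map_comp; congr flatten; apply: eq_map => x.
  by rewrite /= map_rev.
(* The third equation is [rot] with the list of blocks read backwards. *)
rewrite -flatten_rcons -rev_cons map_flatten map_rev rot.
by rewrite rev_rcons.
Qed.

(** The case hypotheses describe only the concatenation [z1 ++ z3]; this recovers the cut. If [z1]
    were longer than [p], it would contain a letter of [q], already present in [p]; if it were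
    shorter, [z3] would contain a letter of [p] and then all of [q], where that letter recurs. *)
Lemma half_unique (z1 z3 p q : word) : uniq z1 -> uniq z3 -> p =i q ->
  z1 ++ z3 = p ++ q -> z1 = p /\ z3 = q.
Proof.
move=> u1 u3 pq e.
have s : size z1 = size p.
  apply/eqP; rewrite eqn_leq; apply/andP.
  split; rewrite leqNgt; apply/negP=> lt.
    have e1 : z1 = p ++ drop (size p) z1.
      by rewrite -{1}(cat_take_drop (size p) z1) -(takel_cat z3 (ltnW lt)) e
        take_size_cat.
    have e2 : drop (size p) z1 ++ z3 = q.
      by rewrite -(drop_size_cat q (erefl (size p))) -e drop_cat lt.
    have : size (drop (size p) z1) > 0 by rewrite size_drop subn_gt0.
    case E : (drop _ _) => [//|c r] _; move: u1; rewrite e1 E cat_uniq.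
    by rewrite /= pq -e2 E mem_head andbF.
  have e1 : z3 = drop (size z1) p ++ q.
    by rewrite -(drop_size_cat z3 (erefl (size z1))) e drop_cat lt.
  have : size (drop (size z1) p) > 0 by rewrite size_drop subn_gt0.
  case E : (drop _ _) => [//|c r] _; move: u3; rewrite e1 E /=.
  by rewrite mem_cat -pq (@mem_drop (size z1) _ p) ?E ?mem_head // orbT.
by move/eqP: e; rewrite eqseq_cat // => /andP[/eqP-> /eqP->].
Qed.

(** * Fresh letters, positivity and positions of insertions *)

Lemma new_word_fresh nu w : {in new_word nu w, forall c, c \notin w}.
Proof.
move=> c; rewrite mem_iota => /andP[lt _]; apply/negP => cw.
have : c <= max_symbol w by apply: leq_bigmax_seq.
by move: lt; lia.
Qed.

(** The first 0 could be neither the head, which is 1, nor a later first occurrence, which is a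
    successor. This matters because an [equivalent] renaming has to fix 0. *)
Lemma ascending_pos w : ascending w -> 0 \notin w.
Proof.
case=> [-> //|[hd asc]]; apply/negP => w0.
have iw : index 0 w < size w by rewrite index_mem.
have n0 : nth 0 w (index 0 w) = 0 by rewrite nth_index.
have i0 : 0 < index 0 w.
  by rewrite lt0n; apply/eqP => i0; move: n0; rewrite i0 nth0 hd.
have := asc (index 0 w); rewrite i0 iw n0 => /(_ isT).
have nt : 0 \notin take (index 0 w) w.
  by apply/negP => /index_ltn; rewrite ltnn.
by move/(_ nt).
Qed.

Lemma insert_cat I nu w a x b (u := new_word nu w) : w = a ++ x ++ b ->
  insert w I nu (size a + 1) (size (a ++ x) + 1)
  = a ++ u ++ x ++ copy I u ++ b.
Proof.
rewrite /insert !addnK -/u => ->; rewrite take_size_cat //.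
by rewrite [a ++ x ++ b]catA take_size_cat // !drop_size_cat.
Qed.

Lemma insertion_positions_cat w a x b : w = a ++ x ++ b ->
  insertion_positions w (size a + 1) (size (a ++ x) + 1).
Proof. by move=> ->; split; rewrite ?size_cat; lia. Qed.

Lemma count_halves (p q : word) : p =i q ->
  {in p, forall c, 1 < count_mem c (p ++ q)}.
Proof.
move=> pq c cp; have := cp; rewrite pq; move: cp.
by rewrite -!has_pred1 !has_count count_cat; lia.
Qed.

Lemma size_gt0_eqi (p q : word) : p <> [::] -> p =i q ->
  0 < size p /\ 0 < size q.
Proof.
case: p => // c p _ pq; split=> //.
by have := pq c; case: q {pq}; rewrite ?mem_head.
Qed.

(** * From a local renaming to a pair of equivalent insertions into [w] *)

Section Insertions.

Variables (w : word) (nu : nat) (I : insertion_kind).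
Hypotheses (w_dow : dow w) (w_pos : 0 \notin w).
Let u := new_word nu w.

Lemma fixes_off_zero S f : fixes_off S f -> {subset S <= u ++ w} -> f 0 = 0.
Proof.
move=> Sf sub; apply: Sf; apply/negP => /sub.
by rewrite mem_cat (negbTE w_pos) orbF mem_iota addn1.
Qed.

(** A letter of [S] already uses up in [s] its two occurrences in [w], so none is left for [z]; the
    letters of [u] do not occur in [w] at all. *)
Lemma fixed_outside S s z f : fixes_off (u ++ S) f -> perm_eq w (s ++ z) ->
  {in S, forall c, 1 < count_mem c s} -> map f z = z.
Proof.
move=> Sf /[dup] wp /permP wsz S2; apply: map_fixed Sf _ => c cz.
rewrite mem_cat; apply/negP => /orP[/new_word_fresh|/S2].
  by rewrite (perm_mem wp) mem_cat cz orbT.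
move: cz; rewrite -has_pred1 has_count.
by have := w_dow c; rewrite wsz count_cat; lia.
Qed.

(** With u' the second copy of u, the results are a u p c u' q b and a p u c q u' b, so [f] only has
    to move u past p and u' past q. The inequalities are strict because p and q are nonempty. *)
Lemma interleaving_insertions a p c q b f :
  w = a ++ p ++ c ++ q ++ b -> p <> [::] -> p =i q ->
  bijective f -> fixes_off (u ++ p) f ->
  map f (u ++ p) = p ++ u -> map f (copy I u ++ q) = q ++ copy I u ->
  exists k1 l1 k2 l2, equivalent_insertions w nu I k1 l1 I k2 l2 /\
    interleaving k1 l1 k2 l2.
Proof.
move=> ew p0 pq bf ff f1 f2; have [sp sq] := size_gt0_eqi p0 pq.
have : map f (a ++ c ++ b) = a ++ c ++ b.
  apply: fixed_outside ff _ (count_halves pq); rewrite ew.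
  by apply/permP => P; rewrite !count_cat; lia.
rewrite !map_cat => /eqP; rewrite !eqseq_cat ?size_map //.
case/and3P => /eqP fa /eqP fc /eqP fb.
have e1 : w = a ++ (p ++ c) ++ (q ++ b) by rewrite ew -!catA.
have e2 : w = (a ++ p) ++ (c ++ q) ++ b by rewrite ew -!catA.
exists (size a + 1), (size (a ++ (p ++ c)) + 1), (size (a ++ p) + 1),
  (size ((a ++ p) ++ (c ++ q)) + 1); split; last first.
  by split; rewrite !size_cat; lia.
split; first exact: insertion_positions_cat e1.
- exact: insertion_positions_cat e2.
- by case=> + _; rewrite !size_cat; lia.
exists f; split=> //.
  apply: fixes_off_zero ff _ => x; rewrite ew !mem_cat.
  by case/orP=> ->; rewrite ?orbT.
rewrite (insert_cat I nu e1) (insert_cat I nu e2) -/u.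
by rewrite -!catA [u ++ p ++ _]catA [copy I u ++ q ++ _]catA map_cat fa
  map_cat f1 map_cat fc map_cat f2 fb -!catA.
Qed.

(** Here the results are a u p c q u' b and a p u c u' q b: on the right side u' moves in the
    opposite direction. *)
Lemma nested_insertions a p c q b f :
  w = a ++ p ++ c ++ q ++ b -> p <> [::] -> p =i q ->
  bijective f -> fixes_off (u ++ p) f ->
  map f (u ++ p) = p ++ u -> map f (q ++ copy I u) = copy I u ++ q ->
  exists k1 l1 k2 l2, equivalent_insertions w nu I k1 l1 I k2 l2 /\
    nested k1 l1 k2 l2.
Proof.
move=> ew p0 pq bf ff f1 f2; have [sp sq] := size_gt0_eqi p0 pq.
have : map f (a ++ c ++ b) = a ++ c ++ b.
  apply: fixed_outside ff _ (count_halves pq); rewrite ew.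
  by apply/permP => P; rewrite !count_cat; lia.
rewrite !map_cat => /eqP; rewrite !eqseq_cat ?size_map //.
case/and3P => /eqP fa /eqP fc /eqP fb.
have e1 : w = a ++ (p ++ c ++ q) ++ b by rewrite ew -!catA.
have e2 : w = (a ++ p) ++ c ++ (q ++ b) by rewrite ew -!catA.
exists (size a + 1), (size (a ++ (p ++ c ++ q)) + 1), (size (a ++ p) + 1),
  (size ((a ++ p) ++ c) + 1); split; last first.
  by split; rewrite !size_cat; lia.
split; first exact: insertion_positions_cat e1.
- exact: insertion_positions_cat e2.
- by case=> + _; rewrite !size_cat; lia.
exists f; split=> //.
  apply: fixes_off_zero ff _ => x; rewrite ew !mem_cat.
  by case/orP=> ->; rewrite ?orbT.
rewrite (insert_cat I nu e1) (insert_cat I nu e2) -/u.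
by rewrite -!catA [u ++ p ++ _]catA [q ++ copy I u ++ _]catA map_cat fa
  map_cat f1 map_cat fc map_cat f2 fb -!catA.
Qed.

(** The first insertion encloses the first [m] letters of [s], the second the last [m]. The strict
    bound on [m.*2] keeps at least one letter between them, which gives [l1 < k2]. *)
Lemma sequential_insertions a s b m f :
  w = a ++ s ++ b -> m.*2 < size s -> {in s, forall c, 1 < count_mem c s} ->
  bijective f -> fixes_off (u ++ s) f ->
  map f (left_insert I m u s) = right_insert I m u s ->
  exists k1 l1 k2 l2, equivalent_insertions w nu I k1 l1 I k2 l2 /\
    sequential k1 l1 k2 l2.
Proof.
move=> ew sm s2 bf ff f1.
have : map f (a ++ b) = a ++ b.
  apply: fixed_outside ff _ s2; rewrite ew.
  by apply/permP => P; rewrite !count_cat; lia.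
rewrite !map_cat => /eqP; rewrite !eqseq_cat ?size_map //.
case/andP => /eqP fa /eqP fb.
set n := size s - m.
have e1 : w = a ++ take m s ++ (drop m s ++ b).
  by rewrite ew [take m s ++ _]catA cat_take_drop.
have e2 : w = (a ++ take n s) ++ drop n s ++ b.
  by rewrite ew -catA [take n s ++ _]catA cat_take_drop.
exists (size a + 1), (size (a ++ take m s) + 1), (size (a ++ take n s) + 1),
  (size ((a ++ take n s) ++ drop n s) + 1); split; last first.
  by split; rewrite !size_cat ?size_drop ?size_take_min /n; lia.
split; first exact: insertion_positions_cat e1.
- exact: insertion_positions_cat e2.
- by case=> + _; rewrite !size_cat ?size_take_min /n; lia.
exists f; split=> //.
  apply: fixes_off_zero ff _ => x; rewrite ew !mem_cat.
  by case/orP=> ->; rewrite ?orbT.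
rewrite (insert_cat I nu e1) (insert_cat I nu e2) -/u.
have -> : a ++ u ++ take m s ++ copy I u ++ drop m s ++ b
  = a ++ left_insert I m u s ++ b by rewrite /left_insert -!catA.
by rewrite map_cat fa map_cat f1 fb /right_insert -/n -!catA.
Qed.

End Insertions.

(** * The invariant of tangled cords and its preservation *)

(* The invariant of the tangled cords: inserting at the left end of [s] and
   inserting at its right end give equivalent words, for every fresh [u]. *)
Definition cordlike (I : insertion_kind) (nu m : nat) (s : word) : Prop :=
  [/\ m.*2 <= size s, {in s, forall c, 1 < count_mem c s} &
   forall u, uniq u -> size u = nu -> {in u, forall c, c \notin s} ->
     exists f, [/\ bijective f, fixes_off (u ++ s) f &
       map f (left_insert I m u s) = right_insert I m u s]].

Lemma map_left_insert I m f u s :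
  map f (left_insert I m u s) = left_insert I m (map f u) (map f s).
Proof. by rewrite !map_cat map_take map_drop map_copy. Qed.

Lemma map_right_insert I m f u s :
  map f (right_insert I m u s) = right_insert I m (map f u) (map f s).
Proof.
by rewrite /right_insert size_map !map_cat map_take map_drop map_copy.
Qed.

Lemma count_right_insert I m u s P :
  count P (right_insert I m u s) = count P s + (count P u).*2.
Proof.
by rewrite -[in RHS](cat_take_drop (size s - m) s) !count_cat count_copy; lia.
Qed.

Lemma size_right_insert I m u s :
  size (right_insert I m u s) = size s + (size u).*2.
Proof. by rewrite -!(count_predT) count_right_insert. Qed.

Lemma mem_right_insert I m u s c :
  (c \in right_insert I m u s) = (c \in u) || (c \in s).
Proof.
rewrite -!has_pred1 !has_count count_right_insert.
by rewrite addn_gt0 double_gt0 orbC.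
Qed.

(** The bound keeps the two ends of length [m] disjoint: s = x y z with |x| = |z| = m, and both
    sides are u x u' y v z v', where u' and v' are the second copies. *)
Lemma left_right_insertC I m u v s : m.*2 <= size s ->
  left_insert I m u (right_insert I m v s)
  = right_insert I m v (left_insert I m u s).
Proof.
move=> sm; have [x [y [z [-> sx sz]]]] :
    exists x y z, [/\ s = x ++ y ++ z, size x = m & size z = m].
  exists (take m s), (take (size s - m.*2) (drop m s)), (drop (size s - m) s).
  rewrite size_drop size_takel; last by lia.
  split=> //; last by lia.
  rewrite -[in LHS](cat_take_drop m s).
  rewrite -[in LHS](cat_take_drop (size s - m.*2) (drop m s)) drop_drop.
  by congr (_ ++ (_ ++ drop _ _)); lia.
have re v' x' t : t = x' ++ z ->
    right_insert I m v' t = x' ++ v' ++ z ++ copy I v'.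
  move=> ->; rewrite /right_insert size_cat sz addnK.
  by rewrite take_size_cat // drop_size_cat.
have le v' y' t : t = x ++ y' ->
    left_insert I m v' t = v' ++ x ++ copy I v' ++ y'.
  by move=> ->; rewrite /left_insert take_size_cat // drop_size_cat.
rewrite (re v _ _ (catA x y z)) (le u _ _ (erefl (x ++ y ++ z))).
rewrite (le u _ _ (esym (catA x y _))).
rewrite (re v (u ++ x ++ copy I u ++ y)); by rewrite -!catA.
Qed.

(** When [s] consists of two halves of length [m], left insertion gives u p u' q and right insertion
    p u q u'. So moving u past p and u' past q suffices. *)
Lemma cordlike_base I nu m (p q : word) : size p = m -> uniq p -> p =i q ->
  size q = m ->
  (forall u, uniq u -> size u = nu -> {in u, forall c, c \notin p} ->
     exists f, [/\ bijective f, fixes_off (u ++ p) f,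
       map f (u ++ p) = p ++ u &
       map f (copy I u ++ q) = q ++ copy I u]) ->
  cordlike I nu m (p ++ q).
Proof.
move=> sp up pq sq rot; split; first by rewrite size_cat sp sq addnn.
  by move=> c; rewrite mem_cat -pq orbb; apply: count_halves.
move=> u uu su us; have [c cu|f [bf ff f1 f2]] := rot u uu su.
  by apply: contra (us c cu); rewrite mem_cat => ->.
exists f; split=> //.
  by apply: fixes_off_sub ff => c; rewrite !mem_cat => /orP[]->; rewrite ?orbT.
rewrite /left_insert /right_insert size_cat sq addnK.
rewrite (take_size_cat _ sp) (drop_size_cat _ sp).
rewrite take_size_cat // drop_size_cat //.
by rewrite [u ++ p ++ _]catA map_cat f1 f2 -!catA.
Qed.

Lemma cordlike_step I nu m u s : uniq u -> size u = nu ->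
  {in u, forall c, c \notin s} -> cordlike I nu m s ->
  cordlike I nu m (right_insert I m u s).
Proof.
move=> uu su us [sm s2 rot]; split.
- by rewrite size_right_insert; lia.
- move=> c; rewrite mem_right_insert count_right_insert => /orP[|/s2].
    by rewrite -has_pred1 has_count; set k := count _ u; lia.
  by move/leq_trans; apply; apply: leq_addr.
move=> v uv sv vs'.
have vs : {in v, forall c, c \notin s}.
  by move=> c /vs'; rewrite mem_right_insert => /norP[].
have vu : {in v, forall c, c \notin u}.
  by move=> c /vs'; rewrite mem_right_insert => /norP[].
have [f [bf ff f1]] := rot v uv sv vs.
have fu : map f u = u.
  apply: map_fixed ff _ => c cu; rewrite mem_cat negb_or us // andbT.
  by apply/negP => /vu; rewrite cu.
have [|h [bh fh hm]] := @swap_renaming u v.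
  rewrite cat_uniq uu uv andbT /=; apply/hasPn => c /vu //.
have hs : map h s = s.
  apply: map_fixed fh _ => c cs; rewrite mem_cat.
  by apply/negP => /orP[/us|/vs]; rewrite cs.
(* Since [u] and [v] both have length [nu], turning [u ++ v] into [v ++ u] means exchanging the two
   words letter by letter. *)
move/eqP: hm; rewrite map_cat eqseq_cat ?size_map ?su ?sv //.
case/andP => /eqP hu /eqP hv.
exists (h \o f); split; first exact: bij_comp.
  move=> c; rewrite mem_cat mem_right_insert !negb_or => /and3P[cv cu cs].
  by rewrite /= ff ?fh // mem_cat negb_or ?cv ?cu.
rewrite map_comp left_right_insertC // map_right_insert f1 fu.
by rewrite !map_right_insert hu hv hs.
Qed.

(** By conjugation: pull [u] back along the inverse [h] of [g], rename there by [f], and push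
    forward by [g]. *)
Lemma cordlike_map I nu m g s : bijective g -> cordlike I nu m s ->
  cordlike I nu m (map g s).
Proof.
move=> bg [sm s2 rot]; have [h gK hK] := bg.
have ig := bij_inj bg; have ih := can_inj hK; split.
- by rewrite size_map.
- move=> _ /mapP[c cs ->]; rewrite count_map (eq_count (a2 := pred1 c)) ?s2 //.
  by move=> x /=; rewrite inj_eq.
move=> u uu su us; have [||c|f [bf ff f1]] := rot (map h u).
- by rewrite map_inj_uniq.
- by rewrite size_map.
- by case/mapP => x xu ->; apply: contra (us x xu) => /(map_f g); rewrite hK.
exists (g \o f \o h); split.
- by apply: bij_comp; [apply: bij_comp | exists g].
- move=> c cus /=; rewrite ff ?hK //; apply: contra cus => /(map_f g).
  by rewrite hK map_cat (mapK hK).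
rewrite 2!map_comp map_left_insert (mapK gK) f1.
by rewrite map_right_insert (mapK hK).
Qed.


Lemma insert_right I nu m s :
  insert s I nu (size s - m + 1) (size s + 1)
  = right_insert I m (new_word nu s) s.
Proof.
by rewrite /insert !addnK take_size drop_size cats0.
Qed.

Lemma cordlike_insert I nu m s : cordlike I nu m s ->
  cordlike I nu m (insert s I nu (size s - m + 1) (size s + 1)).
Proof.
move=> cs; rewrite insert_right; apply: cordlike_step => //.
- exact: iota_uniq.
- exact: size_iota.
- exact: new_word_fresh.
Qed.

(** An insertion lengthens the word by twice [nu], so the weak bound of the invariant becomes the
    strict one that sequential insertions need. This is where [j >= 1] enters. *)
Lemma cordlike_insert_size I nu m s : 0 < nu -> cordlike I nu m s ->
  m.*2 < size (insert s I nu (size s - m + 1) (size s + 1)).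
Proof.
by move=> nu0 [sm _ _]; rewrite insert_right size_right_insert size_iota; lia.
Qed.

(** * Tangled cords satisfy the invariant *)

Lemma cordlike_T_rho nu m j : cordlike Repeat nu m (T_rho nu m j).
Proof.
elim: j => [|j IH] /=; last exact: cordlike_insert.
apply: cordlike_base; rewrite ?size_iota ?iota_uniq // => u uu _ us.
have [|f [bf ff mf]] := @swap_renaming u (iota 1 m); last by exists f.
rewrite cat_uniq uu iota_uniq andbT.
by apply/hasPn => c; apply: contraL; apply: us.
Qed.

Lemma flatten_blocks nu h :
  flatten [seq block nu i | i <- iota 1 h] = iota 1 (h * nu).
Proof.
elim: h => // h IH; rewrite -[h.+1]addn1 iotaD map_cat flatten_cat IH /= cats0.
by rewrite mulnDl mul1n iotaD /block add1n subn1 addnC.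
Qed.

Lemma size_blocks nu h :
  all (fun x => size x == nu) [seq block nu i | i <- iota 1 h].
Proof. by rewrite all_map; apply/allP => i _; rewrite /= size_iota. Qed.

Lemma cordlike_T_tau nu m j : nu %| m -> cordlike Return nu m (T_tau nu m j).
Proof.
move=> num; elim: j => [|j IH] /=; last exact: cordlike_insert.
have rw : flatten [seq rev (block nu i) | i <- iota 1 (m %/ nu)]
  = flatten (map rev [seq block nu i | i <- iota 1 (m %/ nu)]).
  by rewrite -map_comp.
(* Divisibility makes each half of the initial [Int] word exactly [m] letters long. *)
have sz : size (flatten [seq block nu i | i <- iota 1 (m %/ nu)]) = m.
  by rewrite flatten_blocks size_iota divnK.
apply: cordlike_base => //.
- by rewrite flatten_blocks iota_uniq.
- by move=> c; rewrite rw mem_flatten_map_rev.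
- rewrite -[RHS]sz !size_flatten /shape -!map_comp; congr sumn.
  by apply: eq_map => i /=; rewrite size_rev.
move=> u uu su us; rewrite rw.
have [||f [bf ff f1 f2 _]] :=
    @block_rotation u [seq block nu i | i <- iota 1 (m %/ nu)].
- by rewrite su size_blocks.
- rewrite cat_uniq uu flatten_blocks iota_uniq andbT.
  by apply/hasPn => c; apply: contraL => /us; rewrite flatten_blocks.
by exists f.
Qed.

Lemma cord_insertions w nu I m a t s b : dow w -> 0 \notin w ->
  w = a ++ t ++ b -> equivalent t s -> cordlike I nu m s -> m.*2 < size s ->
  exists k1 l1 k2 l2, equivalent_insertions w nu I k1 l1 I k2 l2 /\
    sequential k1 l1 k2 l2.
Proof.
move=> dw pw ew [f [[g fK gK] _ fts]] cs ms.
(* The invariant is transported from the cord [s] back to the factor [t] of [w] by the inverse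
   renaming. *)
have ct : cordlike I nu m t.
  by rewrite -(mapK fK t) fts; apply: cordlike_map cs; exists f.
have [sm s2 rot] := ct.
have [|||h [bh fh h1]] := rot (new_word nu w).
- exact: iota_uniq.
- exact: size_iota.
- move=> c /new_word_fresh; apply: contra => ct'.
  by rewrite ew !mem_cat ct' orbT.
apply: (sequential_insertions dw pw ew _ s2 bh fh h1).
by rewrite -(size_map f t) fts.
Qed.

Lemma uniq_new_word_cat nu w v : uniq v -> {subset v <= w} ->
  uniq (new_word nu w ++ v).
Proof.
move=> uv sub; rewrite cat_uniq iota_uniq uv andbT.
by apply/hasPn => c /sub; apply: contraL; apply: new_word_fresh.
Qed.

(** * The six cases *)

Theorem theorem4p3 (w : word) (nu : nat) (z1 z2 z3 : word)
    (w_dow : dow w) (w_asc : ascending w) (nu_gt0 : 1 <= nu)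
    (z1_sow : sow z1) (z3_sow : sow z3) (z_factor : factor (z1 ++ z2 ++ z3) w) :
  let case1 := repeat_word_in (z1 ++ z3) w in
  let case2 := exists h, 1 <= h /\ equivalent (z1 ++ z3) (Int h nu) in
  let case3 := exists h, 1 <= h /\ equivalent (z1 ++ z3) (Nes h nu) in
  let case4 := return_word_in (z1 ++ z3) w in
  let case5 := exists m j, 1 <= j /\
    equivalent (z1 ++ z2 ++ z3) (T_rho nu m j) in
  let case6 := exists m j, [/\ nu %| m, 1 <= j &
    equivalent (z1 ++ z2 ++ z3) (T_tau nu m j)] in
  (case1 \/ case2 \/ case3 \/ case4 \/ case5 \/ case6 ->
    exists I1 k1 l1 I2 k2 l2, equivalent_insertions w nu I1 k1 l1 I2 k2 l2) /\
  (case1 -> exists k1 l1 k2 l2,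
    equivalent_insertions w nu Repeat k1 l1 Repeat k2 l2 /\
    interleaving k1 l1 k2 l2) /\
  (case2 -> exists k1 l1 k2 l2,
    equivalent_insertions w nu Return k1 l1 Return k2 l2 /\
    interleaving k1 l1 k2 l2) /\
  (case3 -> exists k1 l1 k2 l2,
    equivalent_insertions w nu Repeat k1 l1 Repeat k2 l2 /\
    nested k1 l1 k2 l2) /\
  (case4 -> exists k1 l1 k2 l2,
    equivalent_insertions w nu Return k1 l1 Return k2 l2 /\
    nested k1 l1 k2 l2) /\
  (case5 -> exists k1 l1 k2 l2,
    equivalent_insertions w nu Repeat k1 l1 Repeat k2 l2 /\
    sequential k1 l1 k2 l2) /\
  (case6 -> exists k1 l1 k2 l2,
    equivalent_insertions w nu Return k1 l1 Return k2 l2 /\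
    sequential k1 l1 k2 l2).
Proof.
have w_pos := ascending_pos w_asc; have [z1n z1u] := z1_sow.
have [_ z3u] := z3_sow; have [a [b ew]] := z_factor.
have ew' : w = a ++ z1 ++ z2 ++ z3 ++ b by rewrite ew -!catA.
have z1w : {subset z1 <= w} by move=> c cz; rewrite ew !mem_cat cz orbT.
have u1 := uniq_new_word_cat nu z1u z1w.
move=> case1 case2 case3 case4 case5 case6.
have H1 : case1 -> exists k1 l1 k2 l2,
    equivalent_insertions w nu Repeat k1 l1 Repeat k2 l2 /\
    interleaving k1 l1 k2 l2.
  case=> v [_ e _]; have [e1 e3] := half_unique z1u z3u (fun=> erefl) e.
  have [f [bf ff f1]] := swap_renaming u1.
  by apply: (interleaving_insertions w_dow w_pos ew' z1n _ bf ff f1);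
    rewrite e3 -e1.
have H4 : case4 -> exists k1 l1 k2 l2,
    equivalent_insertions w nu Return k1 l1 Return k2 l2 /\
    nested k1 l1 k2 l2.
  case=> v [_ e _]; have vr : v =i rev v by move=> c; rewrite mem_rev.
  have [e1 e3] := half_unique z1u z3u vr e.
  have [f [bf ff f1]] := swap_renaming u1.
  apply: (nested_insertions w_dow w_pos ew' z1n _ bf ff f1);
    rewrite e3 -e1.
  - by move=> c; rewrite mem_rev.
  (* The equation for the right half is the reversal of [f1], since [rev z1 ++ rev u] is
     [rev (u ++ z1)]. *)
  - by rewrite /= -rev_cat map_rev f1 rev_cat.
have blocks h (g : nat -> nat) (X := [seq map g (block nu i) | i <- iota 1 h]) :
    all (fun x => size x == size (new_word nu w)) X.
  by rewrite all_map; apply/allP => i _; rewrite /= size_map !size_iota.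
have H2 : case2 -> exists k1 l1 k2 l2,
    equivalent_insertions w nu Return k1 l1 Return k2 l2 /\
    interleaving k1 l1 k2 l2.
  case=> h [_ [f' [[g fK gK] _ e]]].
  (* The inverse renaming [g] exhibits [z1 ++ z3] as an image of the model word, whose image blocks
     form the list [X] to be rotated. *)
  have {e} : z1 ++ z3 = map g (Int h nu) by rewrite -e mapK.
  pose X := [seq map g (block nu i) | i <- iota 1 h].
  have -> : map g (Int h nu) = flatten X ++ flatten (map rev X).
    rewrite map_cat !map_flatten -!map_comp; congr (_ ++ flatten _).
    by apply: eq_map => i /=; rewrite map_rev.
  have pq : flatten X =i flatten (map rev X).
    by move=> c; rewrite mem_flatten_map_rev.
  move/(half_unique z1u z3u pq) => [e1 e3].
  rewrite e1 in u1; have [f [bf ff f1 f2 _]] := block_rotation (blocks h g) u1.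
  by apply: (interleaving_insertions (f := f) w_dow w_pos ew' z1n);
    rewrite ?e3 ?e1.
have H3 : case3 -> exists k1 l1 k2 l2,
    equivalent_insertions w nu Repeat k1 l1 Repeat k2 l2 /\
    nested k1 l1 k2 l2.
  case=> h [_ [f' [[g fK gK] _ e]]].
  have {e} : z1 ++ z3 = map g (Nes h nu) by rewrite -e mapK.
  pose X := [seq map g (block nu i) | i <- iota 1 h].
  have -> : map g (Nes h nu) = flatten X ++ flatten (rev X).
    by rewrite map_cat !map_flatten -!map_comp map_rev.
  have pq : flatten X =i flatten (rev X).
    by move=> c; rewrite mem_flatten_rev.
  move/(half_unique z1u z3u pq) => [e1 e3].
  rewrite e1 in u1; have [f [bf ff f1 _ f3]] := block_rotation (blocks h g) u1.
  by apply: (nested_insertions (f := f) w_dow w_pos ew' z1n);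
    rewrite ?e3 ?e1.
have H5 : case5 -> exists k1 l1 k2 l2,
    equivalent_insertions w nu Repeat k1 l1 Repeat k2 l2 /\
    sequential k1 l1 k2 l2.
  case=> m [[|j] [//= _ e]].
  apply: (cord_insertions w_dow w_pos ew e).
  - exact: (cordlike_T_rho nu m j.+1).
  - by apply: cordlike_insert_size => //; apply: cordlike_T_rho.
have H6 : case6 -> exists k1 l1 k2 l2,
    equivalent_insertions w nu Return k1 l1 Return k2 l2 /\
    sequential k1 l1 k2 l2.
  case=> m [[|j] [//= num _ e]].
  apply: (cord_insertions w_dow w_pos ew e).
  - exact: (cordlike_T_tau j.+1 num).
  - by apply: cordlike_insert_size => //; apply: cordlike_T_tau.
split; last by [].
by case=> [/H1|[/H2|[/H3|[/H4|[/H5|/H6]]]]] [k1 [l1 [k2 [l2 [H _]]]]];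
  do 6 eexists; exact: H.
Qed.
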